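(* For any frame $L$, the spectrum of the Raney extension $(L,\mathsf{Filt}_{\mathcal{E}}(L)^{op})$ is homeomorphic to the space $\mathsf{pt}_D(L)$. The spectrum of $(L,\mathsf{Filt}_{\mathcal{SE}}(L)^{op})$ is the classical spectrum $\mathsf{pt}(L)$.
   Context: A meet $\bigwedge_i x_i$ in a frame $L$ is exact if $(\bigwedge_i x_i)\vee a=\bigwedge_i(x_i\vee a)$ for all $a\in L$; it is strongly exact if for all $y\in L$, $x_i\to y=y$ for all $i$ implies $(\bigwedge_i x_i)\to y=y$. A filter of $L$ is exact (strongly exact) if it is closed under exact (strongly exact) meets. $\mathsf{Filt}_{\mathcal{E}}(L)$ and $\mathsf{Filt}_{\mathcal{SE}}(L)$ are the collections of exact and strongly exact filters, ordered by inclusion (the improper filter $L$ is included); these are frames. A Raney extension is a pair $(L,C)$ where $C$ is a coframe, $L\subseteq C$ is a frame meet-generating $C$, and the inclusion preserves the frame operations and strongly exact meets. For $C=\mathsf{Filt}_{\mathcal{E}}(L)^{op}$ or $\mathsf{Filt}_{\mathcal{SE}}(L)^{op}$ (ordered by reverse inclusion), each $a\in L$ is identified with its principal filter $\uparrow a$; both pairs in the claim are Raney extensions. The spectrum $\mathsf{pt}_R(L,C)$ of a Raney extension is the set of completely join-prime elements of the coframe $C$ ($x$ such that $x\le\bigvee A$ implies $x\le a$ for some $a\in A$), with open sets $\{x:x\le a\}$ for $a\in L$. $\mathsf{pt}(L)$ is the set of completely prime filters of $L$ (filters $F$ such that $\bigvee_i x_i\in F$ implies $x_i\in F$ for some $i$)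 with open sets $\{P:a\in P\}$, $a\in L$. It is homeomorphic to the space of primes $p\in L$ ($p\neq 1$, $x\wedge y\le p$ implies $x\le p$ or $y\le p$) via $p\mapsto L\setminus{\downarrow}p$, with opens $\{p: a\not\le p\}$. A prime $p$ is covered if $\bigwedge_i x_i=p$ implies $x_i=p$ for some $i$. $\mathsf{pt}_D(L)$ is the set of covered primes with the subspace topology inherited from the space of primes. *)

(* Defs.v *)
From HB Require Import structures.
From mathcomp Require Import all_boot all_order.
From mathcomp Require Import boolp classical_sets topology.

Set Implicit Arguments.
Unset Strict Implicit.
Unset Printing Implicit Defensive.

Import Order.TTheory.
Local Open Scope classical_set_scope.
Local Open Scope order_scope.

HB.mixin Record TBLattice_isComplete d T of Order.TBLattice d T := {
  bigjoin : set T -> T;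
  bigmeet : set T -> T;
  bigjoin_ub : forall (A : set T) x, A x -> x <= bigjoin A;
  bigjoin_le : forall (A : set T) y, (forall x, A x -> x <= y) -> bigjoin A <= y;
  bigmeet_lb : forall (A : set T) x, A x -> bigmeet A <= x;
  bigmeet_ge : forall (A : set T) y, (forall x, A x -> y <= x) -> y <= bigmeet A
}.

#[short(type="completeLatticeType")]
HB.structure Definition CompleteLattice d :=
  { T of Order.TBLattice d T & TBLattice_isComplete d T }.

HB.mixin Record CompleteLattice_isFrame d T of CompleteLattice d T := {
  meet_bigjoin : forall (x : T) (A : set T),
    x `&` bigjoin A = bigjoin [set x `&` y | y in A]
}.

#[short(type="frameType")]
HB.structure Definition Frame d :=
  { T of CompleteLattice d T & CompleteLattice_isFrame d T }.

HB.mixin Record CompleteLattice_isCoframe d T of CompleteLattice d T := {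
  join_bigmeet : forall (x : T) (A : set T),
    x `|` bigmeet A = bigmeet [set x `|` y | y in A]
}.

#[short(type="coframeType")]
HB.structure Definition Coframe d :=
  { T of CompleteLattice d T & CompleteLattice_isCoframe d T }.

HB.instance Definition _ d (T : completeLatticeType d) :=
  TBLattice_isComplete.Build (Order.dual_display d) T^d
    (@bigmeet_lb d T) (@bigmeet_ge d T) (@bigjoin_ub d T) (@bigjoin_le d T).

HB.instance Definition _ d (T : frameType d) :=
  CompleteLattice_isCoframe.Build (Order.dual_display d) T^d
    (@meet_bigjoin d T).

HB.factory Record POrder_isComplete d T of Order.POrder d T := {
  inf : set T -> T;
  inf_lb : forall (A : set T) x, A x -> inf A <= x;
  inf_ge : forall (A : set T) y, (forall x, A x -> y <= x) -> y <= inf A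
}.

HB.builders Context d T of POrder_isComplete d T.

Let sup (A : set T) := inf [set y | forall x, A x -> x <= y].

Fact sup_ub (A : set T) x : A x -> x <= sup A.
Proof. by move=> Ax; apply: inf_ge => y; apply. Qed.

Fact sup_le (A : set T) y : (forall x, A x -> x <= y) -> sup A <= y.
Proof. exact: (@inf_lb [set y | forall x, A x -> x <= y]). Qed.

Fact inf2P x y z : (x <= inf [set w | w = y \/ w = z]) = (x <= y) && (x <= z).
Proof.
apply/idP/andP => [xi|[xy xz]]; last by apply: inf_ge => w [->|->].
by split; apply: (le_trans xi); apply: inf_lb; [left|right].
Qed.

Fact sup2P x y z : (sup [set w | w = x \/ w = y] <= z) = (x <= z) && (y <= z).
Proof.
apply/idP/andP => [si|[xz yz]]; last by apply: sup_le => w [->|->].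
by split; apply: le_trans si; apply: sup_ub; [left|right].
Qed.

HB.instance Definition _ := Order.POrder_MeetJoin_isLattice.Build d T inf2P sup2P.

Fact inf_bottom x : inf setT <= x.
Proof. exact: inf_lb. Qed.

Fact inf_top x : x <= inf set0.
Proof. exact: inf_ge. Qed.

HB.instance Definition _ := Order.hasBottom.Build d T inf_bottom.
HB.instance Definition _ := Order.hasTop.Build d T inf_top.
HB.instance Definition _ :=
  TBLattice_isComplete.Build d T sup_ub sup_le inf_lb inf_ge.

HB.end.

Section Frames.
Context {d : Order.disp_t} {L : frameType d}.
Implicit Types (x y z a : L) (A : set L) (F : set L).

Definition himp x y : L := bigjoin [set z | z `&` x <= y].

(* A family is given by the set A of its members. *)
Definition exact_meet A : Prop :=
  forall a, bigmeet A `|` a = bigmeet [set x `|` a | x in A].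

Definition strongly_exact_meet A : Prop :=
  forall y, (forall x, A x -> himp x y = y) -> himp (bigmeet A) y = y.

Definition lattice_filter F : Prop :=
  [/\ F \top, forall x y, F x -> x <= y -> F y
    & forall x y, F x -> F y -> F (x `&` y)].

Definition closed_under_meets (M : set (set L)) F : Prop :=
  forall A, M A -> A `<=` F -> F (bigmeet A).

Definition completely_prime_filter F : Prop :=
  lattice_filter F /\ forall A, F (bigjoin A) -> exists2 x, A x & F x.

Definition prime_elt (p : L) : Prop :=
  p <> \top /\ forall x y, x `&` y <= p -> x <= p \/ y <= p.

Definition covered (p : L) : Prop := forall A, bigmeet A = p -> A p.

Lemma himpP x y z : (z <= himp x y) = (z `&` x <= y).
Proof.
apply/idP/idP => [zx|]; last by move=> h; apply: bigjoin_ub.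
apply: (le_trans (leI2 zx (lexx x))); rewrite meetC meet_bigjoin.
by apply: bigjoin_le => _ [w /= wxy <-]; rewrite meetC.
Qed.

Lemma le_himp x y : y <= himp x y.
Proof. by rewrite himpP leIl. Qed.

Lemma meetUr_frame x y z : x `&` (y `|` z) = (x `&` y) `|` (x `&` z).
Proof.
apply/eqP; rewrite eq_le leUx !leI2 ?leUl ?leUr // andbT meetC -himpP leUx.
by rewrite !himpP ![_ `&` x]meetC leUl leUr.
Qed.

Lemma joinIr_frame x y z : (x `|` z) `&` (y `|` z) <= (x `&` y) `|` z.
Proof.
rewrite meetUr_frame leUx (le_trans (leIr _ _) (leUr _ _)) andbT meetC.
by rewrite meetUr_frame leUx meetC leUl (le_trans (leIr _ _)) // leUr.
Qed.

Lemma bigmeet_joinr_le A a : bigmeet A `|` a <= bigmeet [set x `|` a | x in A].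
Proof. by apply: bigmeet_ge => _ [x Ax <-]; rewrite leU2 // bigmeet_lb. Qed.

Lemma exact_meet_joinr A a :
  exact_meet A -> exact_meet [set x `|` a | x in A].
Proof.
move=> eA b; rewrite -eA -joinA eA; congr bigmeet.
apply/seteqP; split=> [_ [x Ax <-]|_ [_ [x Ax <-] <-]].
  by exists (x `|` a); [exists x|rewrite joinA].
by exists x => //; rewrite joinA.
Qed.

Lemma strongly_exact_exact A : strongly_exact_meet A -> exact_meet A.
Proof.
move=> sA a; apply/eqP; rewrite eq_le bigmeet_joinr_le /=.
set m := bigmeet [set _ | _ in A]; set y := bigmeet A `|` a.
have hx x : A x -> himp x (himp m y) = himp m y.
  move=> Ax; apply/eqP; rewrite eq_le le_himp andbT himpP.
  set w := himp _ _.
  have wx : w `&` m `&` x <= y by rewrite -meetA [m `&` x]meetC meetA -!himpP.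
  have -> : w `&` m = (w `&` m) `&` (x `|` a).
    apply/esym/meet_idPl; apply: (le_trans (leIr _ _)).
    by apply: bigmeet_lb; exists x.
  by rewrite meetUr_frame leUx wx (le_trans (leIr _ _)) // leUr.
have /(_ (himp m y)) := sA; move=> /(_ hx) e.
have : (\top : L) <= himp m y.
  by rewrite -e !himpP !meet1x; rewrite (le_trans (leIl _ _)) // /y leUl.
by rewrite himpP meet1x.
Qed.

Lemma strongly_exact_joinr A a :
  strongly_exact_meet A -> strongly_exact_meet [set x `|` a | x in A].
Proof.
move=> sA y hy; rewrite -(strongly_exact_exact sA).
set z := himp a y.
have e : himp (bigmeet A) (himp z y) = himp z y.
  apply: sA => x Ax; apply/eqP; rewrite eq_le le_himp andbT.
  set w := himp _ _; rewrite himpP -(hy (x `|` a)); last by exists x.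
  rewrite himpP meetUr_frame leUx; apply/andP; split.
    by rewrite -meetA [z `&` x]meetC meetA -!himpP.
  by apply: (le_trans (leI2 (leIr _ _) (lexx a))); rewrite -himpP lexx.
apply/eqP; rewrite eq_le le_himp andbT.
set w := himp _ _.
have wz : w <= z.
  by rewrite himpP; apply: (le_trans (leI2 (lexx w) (leUr a (bigmeet A)))); rewrite -himpP lexx.
have : w <= himp z y.
  rewrite -e !himpP; apply: (le_trans (leIl _ _)).
  by apply: (le_trans (leI2 (lexx w) (leUl _ a))); rewrite -himpP lexx.
by rewrite himpP (meet_idPl wz).
Qed.

End Frames.

(* Ordered as a subtype of [set L], whose library order [<=] is set inclusion. *)
Definition filt d (L : frameType d) (M : set (set L)) : Type :=
  [set F : set L | lattice_filter F /\ closed_under_meets M F].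

Fact filt_display : Order.disp_t. Proof. exact: (Order.Disp tt tt). Qed.

Section Filt.
Context {d : Order.disp_t} {L : frameType d} (M : set (set L)).

HB.instance Definition _ := SubChoice.on (filt M).
HB.instance Definition _ :=
  [SubChoice_isSubPOrder of filt M by <: with filt_display].

Implicit Types (F G H : filt M) (x y : L).

Lemma filt_leP F G : reflect (val F `<=` val G) (F <= G).
Proof. by rewrite -Order.le_val; apply: (iffP idP) => /subsetPset. Qed.

Lemma filt_filter F : lattice_filter (val F).
Proof. by have [] := set_mem (valP F). Qed.

Lemma filt_closed F : closed_under_meets M (val F).
Proof. by have [] := set_mem (valP F). Qed.

Definition mkfilt (F : set L) (h : lattice_filter F) (c : closed_under_meets M F) :
  filt M := SigSub (mem_set (conj h c)).

Definition capfilt (S : set (filt M)) : set L :=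
  [set x | forall F, S F -> val F x].

Fact capfilt_filter S : lattice_filter (capfilt S).
Proof.
split=> [F _|x y hx xy F SF|x y hx hy F SF]; have [F1 Fle FI] := filt_filter F.
- exact: F1.
- exact: Fle (hx _ SF) xy.
- exact: FI (hx _ SF) (hy _ SF).
Qed.

Fact capfilt_closed S : closed_under_meets M (capfilt S).
Proof.
by move=> A MA AS F SF; apply: filt_closed => // x /AS; apply.
Qed.

Definition infilt S : filt M := mkfilt (capfilt_filter S) (@capfilt_closed S).

Fact infilt_lb S F : S F -> infilt S <= F.
Proof. by move=> SF; apply/filt_leP => x; apply. Qed.

Fact infilt_ge S F : (forall G, S G -> F <= G) -> F <= infilt S.
Proof. by move=> h; apply/filt_leP => x Fx G /h/filt_leP; apply. Qed.

HB.instance Definition _ :=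
  POrder_isComplete.Build filt_display (filt M) infilt_lb infilt_ge.

Fact up_filter x : lattice_filter [set y | x <= y].
Proof.
by split=> [|y z /= xy|y z /= xy xz];
  rewrite /= ?lex1 ?lexI ?xy //; apply: le_trans.
Qed.

Fact up_closed x : closed_under_meets M [set y | x <= y].
Proof. by move=> A _ Ax; apply: bigmeet_ge. Qed.

Definition up x : filt M := mkfilt (up_filter x) (@up_closed x).

Lemma up_leP x F : reflect (val F x) (up x <= F).
Proof.
apply: (iffP (filt_leP _ _)) => [|Fx y /= xy]; first by apply; exact: lexx.
by have [_ Fle _] := filt_filter F; exact: Fle Fx xy.
Qed.

Lemma up_le x y : (up x <= up y) = (y <= x).
Proof. exact: (sameP (up_leP x (up y)) idP). Qed.

Hypothesis M_exact : M `<=` exact_meet.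
Hypothesis M_joinr : forall A a, M A -> M [set x `|` a | x in A].

Definition filt_imp F G : set L := [set a | forall f, val F f -> val G (a `|` f)].

Fact filt_imp_filter F G : lattice_filter (filt_imp F G).
Proof.
have [G1 Gle GI] := filt_filter G.
split=> [f _|x y hx xy f Ff|x y hx hy f Ff].
- by rewrite join1x.
- by apply: Gle (hx _ Ff) _; rewrite leU2.
- exact: Gle (GI _ _ (hx _ Ff) (hy _ Ff)) (joinIr_frame _ _ _).
Qed.

Fact filt_imp_closed F G : closed_under_meets M (filt_imp F G).
Proof.
move=> A MA AFG f Ff; rewrite (M_exact MA).
by apply: filt_closed; [exact: M_joinr|move=> _ [x /AFG hx <-]; exact: hx].
Qed.

Lemma filt_meet_bigjoin F (S : set (filt M)) :
  F `&` bigjoin S = bigjoin [set F `&` G | G in S].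
Proof.
apply/eqP; rewrite eq_le; apply/andP; split; last first.
  by apply: bigjoin_le => _ [G SG <-]; rewrite leI2 // bigjoin_ub.
set H := bigjoin [set _ | _ in S].
pose I : filt M := mkfilt (filt_imp_filter F H) (@filt_imp_closed F H).
have SI : bigjoin S <= I.
  apply: bigjoin_le => G SG; apply/filt_leP => x Gx f Ff.
  have /filt_leP : F `&` G <= H by apply: bigjoin_ub; exists G.
  have [_ Fle _] := filt_filter F; have [_ Gle _] := filt_filter G.
  have : up (x `|` f) <= F `&` G.
    rewrite lexI; apply/andP; split; apply/up_leP.
      by apply: Fle Ff _; rewrite leUr.
    by apply: Gle Gx _; rewrite leUl.
  by move=> /up_leP h; apply.
apply/filt_leP => x Fx.
have /filt_leP/(_ x Fx) {}SFx : F `&` bigjoin S <= bigjoin S by exact: leIr.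
have /filt_leP/(_ x Fx) {}Fx : F `&` bigjoin S <= F by exact: leIl.
by move/filt_leP : SI => /(_ x SFx x Fx); rewrite joinxx.
Qed.

End Filt.

Definition exactFilt d (L : frameType d) : Type := filt (@exact_meet d L).
Definition sexactFilt d (L : frameType d) : Type :=
  filt (@strongly_exact_meet d L).

HB.instance Definition _ d (L : frameType d) :=
  CompleteLattice.on (exactFilt L).
HB.instance Definition _ d (L : frameType d) :=
  CompleteLattice_isFrame.Build filt_display (exactFilt L)
    (filt_meet_bigjoin (fun _ => id) (@exact_meet_joinr d L)).

HB.instance Definition _ d (L : frameType d) :=
  CompleteLattice.on (sexactFilt L).
HB.instance Definition _ d (L : frameType d) :=
  CompleteLattice_isFrame.Build filt_display (sexactFilt L)
    (filt_meet_bigjoin (@strongly_exact_exact d L) (@strongly_exact_joinr d L)).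

Record raneyExtension d d' (L : frameType d) (C : coframeType d') :=
  RaneyExtension {
    raney_incl :> L -> C;
    raney_le : forall x y, (raney_incl x <= raney_incl y) = (x <= y);
    raney_generated : forall c : C, exists A : set L,
      c = bigmeet [set raney_incl x | x in A];
    raney_top : raney_incl \top = \top;
    raney_meet : forall x y,
      raney_incl (x `&` y) = raney_incl x `&` raney_incl y;
    raney_bigjoin : forall A : set L,
      raney_incl (bigjoin A) = bigjoin [set raney_incl x | x in A];
    raney_strongly_exact : forall A : set L, strongly_exact_meet A ->
      raney_incl (bigmeet A) = bigmeet [set raney_incl x | x in A]
  }.

Section FiltRaney.
Context {d : Order.disp_t} {L : frameType d} (M : set (set L)).
Hypothesis M_sexact : @strongly_exact_meet d L `<=` M.
Implicit Types (x y : L) (A : set L) (F : filt M).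

Lemma up_gen F : exists A, F = bigjoin [set up M x | x in A].
Proof.
exists (val F); apply/eqP; rewrite eq_le; apply/andP; split.
  by apply/filt_leP => x Fx; apply/up_leP/bigjoin_ub; exists x.
by apply: bigjoin_le => _ [x Fx <-]; apply/up_leP.
Qed.

Lemma up_top : up M \top = \bot.
Proof.
by apply/eqP; rewrite -lex0; apply/up_leP; case: (filt_filter (\bot : filt M)).
Qed.

Lemma up_meet x y : up M (x `&` y) = up M x `|` up M y.
Proof.
apply/eqP; rewrite eq_le leUx !up_le leIl leIr !andbT; apply/up_leP.
have [_ _ I] := filt_filter (up M x `|` up M y).
by apply: I; apply/up_leP; rewrite ?leUl ?leUr.
Qed.

Lemma up_bigjoin A : up M (bigjoin A) = bigmeet [set up M x | x in A].
Proof.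
apply/eqP; rewrite eq_le; apply/andP; split.
  by apply: bigmeet_ge => _ [x Ax <-]; rewrite up_le bigjoin_ub.
apply/filt_leP => y hy; apply: bigjoin_le => x Ax; rewrite -(up_le M).
apply: (@le_trans _ _ (bigmeet [set up M x | x in A])); first exact/up_leP.
by apply: bigmeet_lb; exists x.
Qed.

Lemma up_strongly_exact A : strongly_exact_meet A ->
  up M (bigmeet A) = bigjoin [set up M x | x in A].
Proof.
move=> /M_sexact MA; apply/eqP; rewrite eq_le; apply/andP; split.
  by apply/up_leP/filt_closed => // x Ax; apply/up_leP/bigjoin_ub; exists x.
by apply: bigjoin_le => _ [x Ax <-]; rewrite up_le bigmeet_lb.
Qed.

End FiltRaney.

(* [T^d] carries the reverse order: its joins are intersections of filters. *)
Definition exactRaney d (L : frameType d) : raneyExtension L (exactFilt L)^d :=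
  @RaneyExtension _ _ L (exactFilt L)^d (@up d L _)
    (fun x y => up_le _ y x) (@up_gen d L _) (@up_top d L _) (@up_meet d L _)
    (@up_bigjoin d L _) (up_strongly_exact (@strongly_exact_exact d L)).

Definition sexactRaney d (L : frameType d) :
    raneyExtension L (sexactFilt L)^d :=
  @RaneyExtension _ _ L (sexactFilt L)^d (@up d L _)
    (fun x y => up_le _ y x) (@up_gen d L _) (@up_top d L _) (@up_meet d L _)
    (@up_bigjoin d L _) (up_strongly_exact (fun _ => id)).

Definition completely_join_prime d (C : completeLatticeType d) (x : C) : Prop :=
  forall A : set C, x <= bigjoin A -> exists2 a, A a & x <= a.

Definition raneyPt d d' (L : frameType d) (C : coframeType d')
    (R : raneyExtension L C) : Type :=
  [set x : C | completely_join_prime x].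

Section RaneyPt.
Context {d d' : Order.disp_t} {L : frameType d} {C : coframeType d'}.
Context (R : raneyExtension L C).

Definition raneyPt_basic (a : L) : set (raneyPt R) := [set x | val x <= R a].
Definition raneyPt_open (U : set (raneyPt R)) : Prop :=
  exists a, U = raneyPt_basic a.

Fact raneyPt_openT : raneyPt_open setT.
Proof.
by exists \top; apply/seteqP; split=> // x _;
  rewrite /raneyPt_basic /= raney_top lex1.
Qed.

Fact raneyPt_openI : setI_closed raneyPt_open.
Proof.
move=> _ _ [a ->] [b ->]; exists (a `&` b); apply/seteqP; split=> x;
  rewrite /raneyPt_basic /= raney_meet lexI.
  by case=> -> ->.
by move/andP.
Qed.

Fact raneyPt_open_bigU (I : Type) (f : I -> set (raneyPt R)) :
  (forall i, raneyPt_open (f i)) -> raneyPt_open (\bigcup_i f i).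
Proof.
move=> fo; exists (bigjoin [set a | exists i, f i = raneyPt_basic a]).
apply/seteqP; split=> [x [i _]|x].
  have [a fa] := fo i; rewrite fa /raneyPt_basic /= => /le_trans; apply.
  by rewrite raney_le; apply: bigjoin_ub; exists i.
rewrite /raneyPt_basic /= raney_bigjoin => /(set_mem (valP x)).
by case=> _ [a [i fa] <-] xa; exists i => //; rewrite fa.
Qed.

HB.instance Definition _ := SubChoice.on (raneyPt R).
HB.instance Definition _ := isOpenTopological.Build (raneyPt R)
  raneyPt_openT raneyPt_openI raneyPt_open_bigU.

End RaneyPt.

Definition pt d (L : frameType d) : Type :=
  [set F : set L | completely_prime_filter F].

Section Pt.
Context {d : Order.disp_t} {L : frameType d}.

Definition pt_basic (a : L) : set (pt L) := [set P | val P a].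
Definition pt_open (U : set (pt L)) : Prop := exists a, U = pt_basic a.

Lemma pt_filter (P : pt L) : lattice_filter (val P).
Proof. by have [] := set_mem (valP P). Qed.

Fact pt_openT : pt_open setT.
Proof. by exists \top; apply/seteqP; split=> // P _; case: (pt_filter P). Qed.

Fact pt_openI : setI_closed pt_open.
Proof.
move=> _ _ [a ->] [b ->]; exists (a `&` b).
apply/seteqP; split=> P; have [_ Ple PI] := pt_filter P.
  by case=> Pa Pb; exact: PI.
by move=> Pab; split; apply: Ple Pab _; rewrite ?leIl ?leIr.
Qed.

Fact pt_open_bigU (I : Type) (f : I -> set (pt L)) :
  (forall i, pt_open (f i)) -> pt_open (\bigcup_i f i).
Proof.
move=> fo; exists (bigjoin [set a | exists i, f i = pt_basic a]).
apply/seteqP; split=> [P [i _]|P].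
  have [a fa] := fo i; rewrite fa => Pa; have [_ Ple _] := pt_filter P.
  by apply: Ple Pa _; apply: bigjoin_ub; exists i.
have [_ PJ] := set_mem (valP P).
by move/PJ => [a [i fa] Pa]; exists i => //; rewrite fa.
Qed.

HB.instance Definition _ := SubChoice.on (pt L).
HB.instance Definition _ :=
  isOpenTopological.Build (pt L) pt_openT pt_openI pt_open_bigU.

End Pt.

Definition primeSpace d (L : frameType d) : Type := [set p : L | prime_elt p].

Section Primes.
Context {d : Order.disp_t} {L : frameType d}.

Definition primeSpace_basic (a : L) : set (primeSpace L) :=
  [set p | ~ (a <= val p)].
Definition primeSpace_open (U : set (primeSpace L)) : Prop :=
  exists a, U = primeSpace_basic a.

Fact primeSpace_openT : primeSpace_open setT.
Proof.
exists \top; apply/seteqP; split=> // p _; rewrite /primeSpace_basic /= le1x.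
by have [p1 _] := set_mem (valP p) => /eqP.
Qed.

Fact primeSpace_openI : setI_closed primeSpace_open.
Proof.
move=> _ _ [a ->] [b ->]; exists (a `&` b).
apply/seteqP; split=> p; rewrite /primeSpace_basic /=.
  by have [_ pP] := set_mem (valP p); case=> ap bp /pP[].
by move=> abp; split=> h; apply: abp;
  [apply: le_trans (leIl _ _) h|apply: le_trans (leIr _ _) h].
Qed.

Fact primeSpace_open_bigU (I : Type) (f : I -> set (primeSpace L)) :
  (forall i, primeSpace_open (f i)) -> primeSpace_open (\bigcup_i f i).
Proof.
move=> fo; exists (bigjoin [set a | exists i, f i = primeSpace_basic a]).
apply/seteqP; split=> [p [i _]|p].
  have [a fa] := fo i; rewrite fa => pa h; apply: pa; apply: le_trans h.
  by apply: bigjoin_ub; exists i.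
move=> h; apply: contrapT => np; apply: h; apply: bigjoin_le => a [i fa].
by apply: contrapT => ap; apply: np; exists i => //; rewrite fa.
Qed.

HB.instance Definition _ := SubChoice.on (primeSpace L).
HB.instance Definition _ := isOpenTopological.Build (primeSpace L)
  primeSpace_openT primeSpace_openI primeSpace_open_bigU.

End Primes.

(* With the subspace topology that the library puts on [set_type]. *)
Definition ptD d (L : frameType d) : Type :=
  [set p : primeSpace L | covered (val p)].
HB.instance Definition _ d (L : frameType d) := Topological.on (ptD L).

Definition homeomorphism (X Y : topologicalType) (f : X -> Y) : Prop :=
  continuous f /\
  exists g : Y -> X, [/\ cancel f g, cancel g f & continuous g].

Definition homeomorphic (X Y : topologicalType) : Prop :=
  exists f : X -> Y, homeomorphism f.

(* Main.v *)
Require Import Defs.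
From HB Require Import structures.
From mathcomp Require Import all_boot all_order.
From mathcomp Require Import boolp classical_sets topology.

(** Joins in the coframe of filters under reverse inclusion are intersections,
    so a point of the Raney spectrum is a filter [F] such that an intersection
    of a family of admissible filters lies inside [F] only if some member of
    the family does.  Whatever the class of admissible filters is, this says
    exactly that [F], itself admissible, is a completely prime filter
    ([completely_join_primeP]).  Testing on the principal filters [up a],
    whose intersection is the principal filter of the join of the [a]'s, shows
    that [F] is completely prime.  Conversely, a completely prime [F] is the
    complement of the down-set of [p], the join of everything outside [F], and
    a filter not contained in [F] must contain [p]; hence so does any
    intersection of such filters, which therefore is not contained in [F].

    Both spectra thus consist of completely prime filters, that is, of
    complements [not_below p] of principal ideals of primes, and it remains to
    see which of these are closed under the meets in question.  All of them
    are closed under strongly exact meets ([not_below_strongly_exact]), since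
    an element [x] with [~ x <= p] satisfies [himp x p = p]; this gives the
    classical spectrum.  Closure under exact meets holds exactly when [p] is
    covered ([not_below_exactP]).  The topologies agree because every space
    involved has one open set for each [a : L], and the bijections match the
    open sets with the same index. *)

Set Implicit Arguments.
Unset Strict Implicit.
Unset Printing Implicit Defensive.

Import Order.TTheory.
Local Open Scope classical_set_scope.
Local Open Scope order_scope.

Section Points.
Context {d : Order.disp_t} {L : frameType d}.
Implicit Types (x y p : L) (A F : set L).

Definition not_below p : set L := [set x | ~ x <= p].

(** For a completely prime [F] this is the prime corresponding to [F]: the
    largest element outside it. *)
Definition join_compl F : L := bigjoin (~` F).

Lemma not_below_completely_prime p :
  prime_elt p -> completely_prime_filter (not_below p).
Proof.
move=> [p1 pI]; split.
  split=> [|x y xp xy yp|x y xp yp /pI[]//]; last exact/xp/(le_trans xy).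
  by rewrite /not_below /= le1x => /eqP.
move=> A Ap; apply: contrapT => nA; apply: Ap; apply: bigjoin_le => x Ax.
by apply: contrapT => xp; apply: nA; exists x.
Qed.

Lemma join_compl_not_below p : join_compl (not_below p) = p.
Proof.
apply/eqP; rewrite eq_le; apply/andP; split.
  by apply: bigjoin_le => x /contrapT.
by apply: bigjoin_ub => /=; apply.
Qed.

Lemma join_compl_notin F : completely_prime_filter F -> ~ F (join_compl F).
Proof. by move=> [_ FJ] /FJ[]. Qed.

Lemma not_below_join_compl F :
  completely_prime_filter F -> not_below (join_compl F) = F.
Proof.
move=> cF; have [[_ Fle _] _] := cF; apply/seteqP; split=> x /=.
  by move=> xp; apply: contrapT => nFx; apply: xp; exact: bigjoin_ub.
by move=> Fx /(Fle _ _ Fx); exact: join_compl_notin.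
Qed.

Lemma join_compl_prime F :
  completely_prime_filter F -> prime_elt (join_compl F).
Proof.
move=> cF; have [[F1 Fle FI] _] := cF; have np := join_compl_notin cF.
split=> [pT|x y xy]; first by rewrite pT in np.
have ge z : ~ F z -> z <= join_compl F by move=> nFz; exact: bigjoin_ub.
have [Fx|/ge] := pselect (F x); last by left.
have [Fy|/ge] := pselect (F y); last by right.
by case: np; exact: Fle (FI _ _ Fx Fy) xy.
Qed.

(** Primality gives [himp x p = p] for each [x] outside the down-set of [p]. If
    the meet of such elements is strongly exact, it shares this property, so it
    cannot lie below [p], as [himp] would then be the top element. *)
Lemma not_below_strongly_exact p :
  prime_elt p -> closed_under_meets strongly_exact_meet (not_below p).
Proof.
move=> [p1 pI] A sA Ap mp; apply: p1; apply/eqP; rewrite -le1x.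
rewrite -(sA p) ?himpP ?meet1x // => x /Ap xp.
apply/eqP; rewrite eq_le le_himp andbT.
have : himp x p `&` x <= p by rewrite -himpP.
by case/pI => // /xp.
Qed.

(** If the meet of [A] is exact and below [p], then [p] is the meet of the
    [x `|` p] with [x] in [A], so a covered [p] equals one of them. Conversely, if
    [p] is the meet of elements other than itself, it is the meet of the set [B]
    of all elements strictly above it. That meet is exact: joining with [b]
    leaves [p] unchanged when [b <= p], and otherwise [p `|` b] belongs to [B]. *)
Lemma not_below_exactP p :
  closed_under_meets exact_meet (not_below p) <-> covered p.
Proof.
split=> [ec A mA|cp A eA Ap mp].
  apply: contrapT => nAp; pose B := [set x | x <> p /\ p <= x].
  (* [A] is contained in [B], and [p] bounds [B] from below. *)
  have mB : bigmeet B = p.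
    apply/eqP; rewrite eq_le; apply/andP; split; last first.
      by apply: bigmeet_ge => x [].
    rewrite -mA; apply: bigmeet_ge => x Ax; apply: bigmeet_lb; split.
      by move=> xp; rewrite -xp in nAp.
    by rewrite -mA bigmeet_lb.
  suff eB : exact_meet B.
    apply: (ec B eB) => [x [xp px] xlep|]; last by rewrite mB.
    by apply: xp; apply/eqP; rewrite eq_le xlep.
  move=> b; apply/eqP; rewrite eq_le bigmeet_joinr_le /= mB.
  have [bp|bp] := pselect (b <= p).
    rewrite (join_idPl bp) -mB; apply: bigmeet_ge => x [xp px].
    apply: bigmeet_lb; exists x => //; apply/join_idPl; exact: le_trans px.
  apply: bigmeet_lb; exists (p `|` b); last by rewrite -joinA joinxx.
  by split; [move=> /join_idPl|exact: leUl].
have [x Ax xp] : [set x `|` p | x in A] p.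
  by apply: cp; rewrite -eA; apply/join_idPr.
by apply: (Ap x Ax); rewrite -xp leUl.
Qed.

(** Principal filters are closed under all meets, so they belong to [filt M] for
    every [M] and can be used to test a point of the spectrum against the joins
    of [L]. Conversely, for a completely prime [F], a filter lies inside [F]
    if and only if it omits the single element [join_compl F], and an
    intersection can omit an element only if one of its members does. *)
Lemma completely_join_primeP (M : set (set L)) (F : filt M) :
  completely_join_prime (F : (filt M)^d) <-> completely_prime_filter (val F).
Proof.
split=> [pF|cF S].
  split=> [|A FA]; first exact: filt_filter.
  have [|_ [a Aa <-] aF] := pF [set up M a | a in A]; last first.
    by exists a => //; apply/up_leP.
  (* The join in the dual lattice is the intersection of the filters. *)
  change (bigmeet [set up M a | a in A] <= F).
  by rewrite -up_bigjoin; apply/up_leP.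
change (@bigmeet _ (filt M) S <= F -> exists2 G : filt M, S G & G <= F) => SF.
(* If no member of [S] is inside [F], then [join_compl F] lies in all of them,
   hence in their intersection, hence in [F]. *)
apply: contrapT => nS; apply: (join_compl_notin cF); apply/up_leP.
apply: le_trans SF; apply: bigmeet_ge => G SG; apply/up_leP.
apply: contrapT => nGp; apply: nS; exists G => //; apply/filt_leP => x Gx.
apply: contrapT => nFx; apply: nGp; have [_ Gle _] := filt_filter G.
by apply: Gle Gx _; exact: bigjoin_ub.
Qed.

End Points.

(** Both topologies are exhausted by families of open sets with a common index,
    so continuity in both directions follows from matching the indices. *)
Lemma homeomorphism_basic (X Y : topologicalType) (I : Type)
    (bX : I -> set X) (bY : I -> set Y) (f : X -> Y) (g : Y -> X) :
  (forall U : set X, open U <-> exists a, U = bX a) ->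
  (forall V : set Y, open V <-> exists a, V = bY a) ->
  (forall a, f @^-1` bY a = bX a) -> cancel f g -> cancel g f ->
  homeomorphism f.
Proof.
move=> oX oY fb fK gK; split.
  by apply/continuousP => _ /oY[a ->]; apply/oX; exists a.
exists g; split=> //; apply/continuousP => _ /oX[a ->]; apply/oY; exists a.
by rewrite -fb; apply/seteqP; split=> y /=; rewrite gK.
Qed.

(** The subspace topology is the initial one for the inclusion, and open sets of
    the space of primes already have the form [primeSpace_basic a]. *)
Lemma open_ptD (d : Order.disp_t) (L : frameType d) (U : set (ptD L)) :
  open U <-> exists a, U = [set p : ptD L | not_below (val (val p)) a].
Proof.
split=> [[_ [a ->] <-]|[a ->]]; first by exists a.
by exists (primeSpace_basic a) => //; exists a.
Qed.

Section Spectra.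
Context {d : Order.disp_t} {L : frameType d}.

Lemma raneyPt_exact_cp (x : raneyPt (exactRaney L)) :
  completely_prime_filter (val (val x : exactFilt L)).
Proof. exact/completely_join_primeP/(set_mem (valP x)). Qed.

Lemma raneyPt_sexact_cp (x : raneyPt (sexactRaney L)) :
  completely_prime_filter (val (val x : sexactFilt L)).
Proof. exact/completely_join_primeP/(set_mem (valP x)). Qed.

Definition raneyPt_to_prime (x : raneyPt (exactRaney L)) : primeSpace L :=
  SigSub (mem_set (join_compl_prime (raneyPt_exact_cp x))).

Lemma raneyPt_to_prime_covered (x : raneyPt (exactRaney L)) :
  [set p : primeSpace L | covered (val p)] (raneyPt_to_prime x).
Proof.
apply/not_below_exactP; rewrite /= (not_below_join_compl (raneyPt_exact_cp x)).
exact: filt_closed.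
Qed.

Definition raneyPt_to_ptD (x : raneyPt (exactRaney L)) : ptD L :=
  SigSub (mem_set (@raneyPt_to_prime_covered x)).

Lemma ptD_cp (p : ptD L) : completely_prime_filter (not_below (val (val p))).
Proof. exact/not_below_completely_prime/(set_mem (valP (val p))). Qed.

Definition ptD_filt (p : ptD L) : exactFilt L :=
  mkfilt (proj1 (ptD_cp p)) (proj2 (not_below_exactP _) (set_mem (valP p))).

Definition ptD_to_raneyPt (p : ptD L) : raneyPt (exactRaney L) :=
  SigSub (mem_set (proj2 (completely_join_primeP (ptD_filt p)) (ptD_cp p))).

Definition raneyPt_to_pt (x : raneyPt (sexactRaney L)) : pt L :=
  SigSub (mem_set (raneyPt_sexact_cp x)).

Lemma completely_prime_strongly_exact (P : set L) :
  completely_prime_filter P -> closed_under_meets strongly_exact_meet P.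
Proof.
move=> cP; rewrite -(not_below_join_compl cP).
exact/not_below_strongly_exact/join_compl_prime.
Qed.

Definition pt_filt (P : pt L) : sexactFilt L :=
  mkfilt (pt_filter P) (completely_prime_strongly_exact (set_mem (valP P))).

Definition pt_to_raneyPt (P : pt L) : raneyPt (sexactRaney L) :=
  SigSub (mem_set
    (proj2 (completely_join_primeP (pt_filt P)) (set_mem (valP P)))).

Lemma raneyPt_to_ptD_homeo : homeomorphism raneyPt_to_ptD.
Proof.
apply: (homeomorphism_basic (I := L) (bX := @raneyPt_basic _ _ _ _ _)
  (g := ptD_to_raneyPt) (fun=> iff_refl _) (@open_ptD _ _)) => [a|x|p].
- apply/seteqP; split=> x; rewrite /raneyPt_basic /=;
    rewrite (not_below_join_compl (raneyPt_exact_cp x)).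
    by move/up_leP.
  by move=> h; apply/up_leP.
- by do 2!apply: val_inj; exact: not_below_join_compl (raneyPt_exact_cp x).
- by do 2!apply: val_inj; exact: join_compl_not_below.
Qed.

Lemma raneyPt_to_pt_homeo : homeomorphism raneyPt_to_pt.
Proof.
apply: (homeomorphism_basic (I := L) (bX := @raneyPt_basic _ _ _ _ _)
  (bY := pt_basic) (g := pt_to_raneyPt)
  (fun=> iff_refl _) (fun=> iff_refl _)) => [a|x|P].
- apply/seteqP; split=> x; rewrite /raneyPt_basic /= => h; first exact/up_leP.
  by move/up_leP: h.
- by do 2!apply: val_inj.
- exact: val_inj.
Qed.

End Spectra.

Theorem lemma3p14 (d : Order.disp_t) (L : frameType d) :
  homeomorphic (raneyPt (exactRaney L)) (ptD L) /\
  exists f : raneyPt (sexactRaney L) -> pt L,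
    homeomorphism f /\
    forall x : raneyPt (sexactRaney L),
      val (f x) = val (val x : sexactFilt L).
Proof.
split; first by exists raneyPt_to_ptD; exact: raneyPt_to_ptD_homeo.
by exists raneyPt_to_pt; split=> //; exact: raneyPt_to_pt_homeo.
Qed.
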